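(* In the lattice $\mathfrak{F}t$ of all functorial topologies on the category of abelian groups, $\gamma=\inf\{\nu,\mathcal P\}$, where $\gamma$ is the profinite topology, $\nu$ is the natural topology and $\mathcal P$ is the Bohr topology. That is, for every abelian group $G$ one has $\gamma_G=\inf\{\nu_G,\mathcal P_G\}$ in the lattice of all group topologies on $G$.
   Context: Group topologies are not assumed Hausdorff; they are ordered by inclusion (coarser $\leq$ finer). A functorial topology is a class $\mathcal T=\{\mathcal T_G: G \text{ an abelian group}\}$, where $\mathcal T_G$ is a group topology on $G$ and every homomorphism $G\to H$ of abelian groups is continuous as a map $(G,\mathcal T_G)\to(H,\mathcal T_H)$. The order on $\mathfrak{F}t$ is: $\mathcal T\leq\mathcal S$ iff $\mathcal T_G\leq\mathcal S_G$ for every abelian group $G$; infima are computed pointwise, i.e. $(\inf\{\mathcal T,\mathcal S\})_G$ is the infimum of $\mathcal T_G$ and $\mathcal S_G$ in the lattice of all group topologies on $G$ (the finest group topology on $G$ coarser than both). For an abelian group $G$: the profinite topology $\gamma_G$ has all finite-index subgroups of $G$ as a base of neighborhoods of $0$; the natural topology $\nu_G$ has $\{mG: m\in\mathbb N_+\}$ as a base of neighborhoods of $0$, where $\mathbb N_+$ is the set of positive integers and $mG=\{mx:x\in G\}$; the Bohr topology $\mathcal P_G$ is the initial topology of all homomorphisms $G\to\mathbb T=\mathbb R/\mathbb Z$, where $\mathbb T$ carries its usual compact topology. *)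

(* Defs.v *)
From HB Require Import structures.
From mathcomp Require Import all_boot all_order all_algebra.
From mathcomp Require Import all_classical reals topology normedtype.

Set Implicit Arguments.
Unset Strict Implicit.
Unset Printing Implicit Defensive.

Import Order.TTheory GRing.Theory Num.Theory.
Import numFieldNormedType.Exports.

Local Open Scope classical_set_scope.
Local Open Scope ring_scope.

Definition is_inf (T : Type) (le : T -> T -> Prop) (a b m : T) : Prop :=
  [/\ le m a, le m b & forall x, le x a -> le x b -> le x m].

(* [gt_class] also carries an eqType/choiceType structure on [G], which is
   irrelevant: topologies are only compared through their open sets. *)
Record group_topology (G : zmodType) := GroupTopology {
  gt_class : Topological G;
  gt_sub_continuous :
    let X : topologicalType := Topological.Pack gt_class in
    continuous ((fun z => (z.1 : G) - (z.2 : G)) : X * X -> X)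
}.

Definition gt_space (G : zmodType) (t : group_topology G) : topologicalType :=
  Topological.Pack (gt_class t).

(* coarser <= finer *)
Definition gt_le (G : zmodType) (s t : group_topology G) : Prop :=
  @open (gt_space s) `<=` @open (gt_space t).

Record functorial_topology := FunctorialTopology {
  ft_top :> forall G : zmodType, group_topology G;
  ft_continuous : forall (G H : zmodType) (f : {additive G -> H}),
    continuous (f : gt_space (ft_top G) -> gt_space (ft_top H))
}.

Definition ft_le (S T : functorial_topology) : Prop :=
  forall G : zmodType, gt_le (S G) (T G).

Definition is_subgroup (G : zmodType) (N : set G) : Prop :=
  N 0 /\ forall x y, N x -> N y -> N (x - y).

Definition coset (G : zmodType) (x : G) (N : set G) : set G :=
  [set x + n | n in N].

Record subgroup_base (G : zmodType) := SubgroupBase {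
  sb_set : set (set G);
  sb_neq0 : sb_set !=set0;
  sb_subgroup : forall N, sb_set N -> is_subgroup N;
  sb_directed : forall M N, sb_set M -> sb_set N ->
    exists2 P, sb_set P & P `<=` M `&` N
}.

Definition sb_space (G : zmodType) (B : subgroup_base G) : Type := G.

Section SubgroupTopology.
Variables (G : zmodType) (B : subgroup_base G).

Definition sb_open : set (set G) :=
  [set U | forall x, U x -> exists2 N, sb_set B N & coset x N `<=` U].

Let sb_openT : sb_open setT.
Proof. by move=> x _; have [N BN] := sb_neq0 B; exists N. Qed.

Let sb_openI : setI_closed sb_open.
Proof.
move=> U V oU oV x [Ux Vx].
have [M BM MU] := oU x Ux; have [N BN NV] := oV x Vx.
have [P BP PMN] := sb_directed BM BN; exists P => // _ [p Pp <-].
by have [Mp Np] := PMN _ Pp; split; [apply: MU|apply: NV]; exists p.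
Qed.

Let sb_open_bigU (I : Type) (f : I -> set G) :
  (forall i, sb_open (f i)) -> sb_open (\bigcup_i f i).
Proof.
move=> of_ x [i _ fix_]; have [N BN NU] := of_ i x fix_.
by exists N => // y /NU ?; exists i.
Qed.

HB.instance Definition _ := Choice.on (sb_space B).
HB.instance Definition _ :=
  isOpenTopological.Build (sb_space B) sb_openT sb_openI sb_open_bigU.

Lemma sb_nbhsE (x : sb_space B) (A : set G) :
  nbhs x A <-> exists2 N, sb_set B N & coset x N `<=` A.
Proof.
split=> [|[N BN NA]].
  rewrite nbhsE => -[U [oU Ux] UA]; have [N BN NU] := oU x Ux.
  by exists N => //; exact: subset_trans UA.
have [N0 NB] := sb_subgroup BN.
rewrite nbhsE; exists (coset x N) => //; split.
  move=> _ [n Nn <-]; exists N => // _ [m Nm <-].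
  exists (n + m); last by rewrite addrA.
  by rewrite -[m]opprK; apply: (NB) => //; rewrite -[- m]add0r; apply: NB.
by exists 0 => //; rewrite addr0.
Qed.

Lemma sb_nbhs0E : nbhs (0 : sb_space B) = filter_from (sb_set B) id.
Proof.
rewrite predeqE => A; rewrite sb_nbhsE; split=> -[N BN NA]; exists N => //.
  by move=> n Nn; apply: NA; exists n; rewrite ?add0r.
by move=> _ [n Nn <-]; rewrite add0r; exact: NA.
Qed.

Lemma sb_sub_continuous :
  continuous ((fun z => (z.1 : G) - (z.2 : G)) :
    sb_space B * sb_space B -> sb_space B).
Proof.
move=> [x y] A /= /sb_nbhsE[N BN NA].
have [N0 NB] := sb_subgroup BN.
exists (coset x N, coset y N) => /=.
  by split; apply/sb_nbhsE; exists N.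
move=> [_ _] [/= [n Nn <-] [m Nm <-]].
apply: NA; exists (n - m); first exact: NB.
by rewrite opprD addrACA.
Qed.

Definition subgroup_topology : group_topology G :=
  @GroupTopology G (Topological.class (sb_space B)) sb_sub_continuous.

End SubgroupTopology.

Lemma sb_hom_continuous (G H : zmodType) (B : subgroup_base G)
    (C : subgroup_base H) (f : {additive G -> H}) :
  (forall N, sb_set C N -> exists2 M, sb_set B M & M `<=` f @^-1` N) ->
  continuous (f : gt_space (subgroup_topology B) ->
                  gt_space (subgroup_topology C)).
Proof.
move=> BC x A /sb_nbhsE[N CN NA]; apply/(@sb_nbhsE G B).
have [M BM MN] := BC N CN; exists M => // _ [m Mm <-].
by apply: NA; exists (f m); [exact: MN|rewrite raddfD].
Qed.

Definition finite_index (G : zmodType) (N : set G) : Prop :=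
  is_subgroup N /\ finite_set [set coset x N | x in [set: G]].

Lemma finite_indexT (G : zmodType) : finite_index [set: G].
Proof.
split=> //; apply: (@sub_finite_set _ _ [set setT]) => // _ [x _ <-].
apply/seteqP; split=> // y _; exists (y - x) => //.
by rewrite addrCA subrr addr0.
Qed.

Lemma finite_indexI (G : zmodType) (M N : set G) :
  finite_index M -> finite_index N -> finite_index (M `&` N).
Proof.
move=> [[M0 MB] finM] [[N0 NB] finN]; split.
  by split=> // x y [? ?] [? ?]; split; [exact: MB|exact: NB].
apply: sub_finite_set (finite_image2 (@setI G) finM finN) => _ [x _ <-].
exists (coset x M); first by exists x.
exists (coset x N); first by exists x.
apply/seteqP; split=> [y [[m Mm <-] [n Nn /addrI nm]]|_ [p [Mp Np] <-]].
  by exists m => //; split=> //; rewrite -nm.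
by split; exists p.
Qed.

Lemma finite_index_preimage (G H : zmodType) (f : {additive G -> H})
  (N : set H) : finite_index N -> finite_index (f @^-1` N).
Proof.
move=> [[N0 NB] finN]; split.
  by split=> [|x y Nx Ny]; rewrite /preimage/= ?raddf0 ?raddfB//; exact: NB.
apply: sub_finite_set (finite_image (preimage f) finN) => _ [x _ <-].
exists (coset (f x) N); first by exists (f x).
apply/seteqP; split=> [y [n Nn fxn]|_ [m Nm <-]].
  exists (y - x); last by rewrite addrCA subrr addr0.
  by rewrite /preimage/= raddfB -fxn addrAC subrr add0r.
by exists (f m); rewrite // raddfD.
Qed.

Definition profinite_base (G : zmodType) : subgroup_base G.
Proof.
refine (@SubgroupBase G [set N | finite_index N] _ _ _).
- by exists setT; exact: finite_indexT.
- by move=> N [].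
- by move=> M N fM fN; exists (M `&` N) => //; exact: finite_indexI.
Defined.

Definition profinite : functorial_topology.
Proof.
apply: (@FunctorialTopology (fun G => subgroup_topology (profinite_base G))).
move=> G H f; apply: sb_hom_continuous => N fN.
by exists (f @^-1` N) => //; exact: finite_index_preimage.
Defined.

Lemma profinite_nbhs0 (G : zmodType) :
  nbhs (0 : gt_space (profinite G)) = filter_from [set N | finite_index N] id.
Proof. exact: (sb_nbhs0E (profinite_base G)). Qed.

Definition multiples (G : zmodType) (m : nat) : set G :=
  [set x *+ m | x in [set: G]].
Arguments multiples : clear implicits.

Definition natural_base (G : zmodType) : subgroup_base G.
Proof.
refine (@SubgroupBase G [set multiples G m | m in [set m | (0 < m)%N]] _ _ _).
- by exists (multiples G 1); exists 1%N.
- move=> _ [m _ <-]; split; first by exists 0; rewrite ?mul0rn.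
  by move=> _ _ [x _ <-] [y _ <-]; exists (x - y); rewrite ?mulrnBl.
- move=> _ _ [m m0 <-] [n n0 <-]; exists (multiples G (m * n)).
    by exists (m * n)%N => //=; rewrite muln_gt0 m0.
  move=> _ [x _ <-]; split; first by exists (x *+ n) => //; rewrite mulnC mulrnA.
  by exists (x *+ m) => //; rewrite mulrnA.
Defined.

Definition natural : functorial_topology.
Proof.
apply: (@FunctorialTopology (fun G => subgroup_topology (natural_base G))).
move=> G H f; apply: sb_hom_continuous => _ [m m0 <-].
exists (multiples G m); first by exists m.
by move=> _ [x _ <-]; exists (f x); rewrite // raddfMn.
Defined.

Lemma natural_nbhs0 (G : zmodType) :
  nbhs (0 : gt_space (natural G)) =
  filter_from [set m | (0 < m)%N] (multiples G).
Proof.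
rewrite (sb_nbhs0E (natural_base G)) predeqE => A.
split=> [[_ [m m0 <-] mA]|[m m0 mA]]; first by exists m.
by exists (multiples G m) => //; exists m.
Qed.

Section Circle.
Variable R : realType.

Definition integer : {pred R} := fun x => x \is a Num.int.

Let integer_zmod_closed : zmod_closed integer.
Proof. by split=> [|x y]; [exact: rpred0|exact: rpredB]. Qed.
HB.instance Definition _ :=
  GRing.isZmodClosed.Build R integer integer_zmod_closed.

Local Notation RZ := (@Quotient.quot R integer).

Definition circle : Type := quotient_topology RZ.

HB.instance Definition _ := Topological.on circle.
HB.instance Definition _ := GRing.isZmodule.Build circle
  (@Quotient.addqA R integer) (@Quotient.addqC R integer)
  (@Quotient.add0q R integer) (@Quotient.addNq R integer).

Definition circle_pi (x : R) : circle := (\pi_RZ x)%qT.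

Lemma circle_piB (x y : R) : circle_pi (x - y) = circle_pi x - circle_pi y.
Proof. exact: (raddfB (\pi_RZ)%qT). Qed.

Lemma circle_pi_surj (t : circle) : exists x, t = circle_pi x.
Proof. by exists (repr (t : RZ)); rewrite /circle_pi reprK. Qed.

Lemma circle_pi_eq (x y : R) : circle_pi x = circle_pi y -> integer (x - y).
Proof.
move=> xy; have /eqP : \pi_RZ%qT x = \pi_RZ%qT y by exact: xy.
by rewrite -Quotient.idealrBE.
Qed.

Lemma circle_pi_open (U : set R) : open U -> open (circle_pi @` U).
Proof.
move=> oU; have -> : open (circle_pi @` U) =
  open (circle_pi @^-1` (circle_pi @` U)) by [].
have -> : circle_pi @^-1` (circle_pi @` U) =
    \bigcup_(n in [set n | integer n]) ((fun x => x - n) @^-1` U).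
  apply/seteqP; split=> [x [y Uy /circle_pi_eq yx]|x [n nZ Uxn]].
    exists (x - y) => /=; last by rewrite subKr.
    by rewrite -opprB; apply: rpredNr.
  exists (x - n) => //; rewrite circle_piB.
  have -> : circle_pi n = 0.
    have -> : n = n - 0 by rewrite subr0.
    suff h : circle_pi n = circle_pi 0 by rewrite circle_piB h subrr.
    have /eqP : (n == 0 %[mod RZ])%qT by rewrite -Quotient.idealrBE subr0.
    by [].
  by rewrite subr0.
apply: bigcup_open => n _; apply: open_comp => // x _.
by apply: continuousB; [exact: cvg_id|exact: cvg_cst].
Qed.

Lemma circle_sub_continuous :
  continuous (fun z : circle * circle => z.1 - z.2).
Proof.
move=> [s t]; have [x ->] := circle_pi_surj s; have [y ->] := circle_pi_surj t.
move=> A /=; rewrite -circle_piB => /(@pi_continuous R RZ (x - y)) pA.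
have : (fun z : R * R => z.1 - z.2) @ (nbhs (x, y)) --> x - y.
  exact: (@sub_continuous R (x, y)).
move=> /(_ _ pA) [[U V] /= [Ux Vy] UV].
move: Ux Vy; rewrite (@nbhsE R x) (@nbhsE R y).
move=> -[U' [oU' U'x] U'U] [V' [oV' V'y] V'V].
exists (circle_pi @` U', circle_pi @` V') => /=.
  by split; apply: open_nbhs_nbhs; split;
    [exact: circle_pi_open|exists x|exact: circle_pi_open|exists y].
move=> [_ _] [/= [u Uu <-] [v Vv <-]]; rewrite -circle_piB.
by apply: (UV (u, v)); split; [exact: U'U|exact: V'V].
Qed.

HB.instance Definition _ :=
  PreTopologicalNmodule_isTopologicalZmodule.Build circle circle_sub_continuous.

End Circle.

Section Bohr.
Variable R : realType.

Definition bohr_space (G : zmodType) : topologicalType :=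
  sup_topology (fun chi : {additive G -> circle R} =>
    Topological.class (initial_topology chi)).

Lemma cvg_bohr (G : zmodType) (F : set_system G) (x : G) : Filter F ->
  F --> (x : bohr_space G) <->
  forall chi : {additive G -> circle R}, chi @ F --> chi x.
Proof.
move=> FF; split=> [/(@cvg_sup G _ _ F x FF) h chi A chixA|h].
  by apply: (h chi); exact: (@initial_continuous G _ chi x A chixA).
apply/(@cvg_sup G _ _ F x FF) => chi A /= [_ [[V oV <-] Vx] VA].
by apply: filterS VA _; apply: (h chi); exact: open_nbhs_nbhs.
Qed.

Lemma bohr_sub_continuous (G : zmodType) :
  continuous ((fun z => (z.1 : G) - (z.2 : G)) :
    bohr_space G * bohr_space G -> bohr_space G).
Proof.
move=> [x y]; apply/cvg_bohr => chi /=.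
have cchi : continuous (chi : bohr_space G -> circle R).
  by move=> u; apply: (@cvg_bohr G (nbhs (u : bohr_space G)) u _).1.
move=> A; rewrite raddfB => /(@circle_sub_continuous R (chi x, chi y) A).
move=> [[U V] /= [/cchi xU /cchi yV] UV].
exists (chi @^-1` U, chi @^-1` V) => // -[u v] [/= uU vV].
by rewrite /= raddfB; exact: (UV (chi u, chi v)).
Qed.

Definition bohr : functorial_topology.
Proof.
apply: (@FunctorialTopology (fun G => @GroupTopology G
  (Topological.class (bohr_space G)) (@bohr_sub_continuous G))).
move=> G H f x.
apply/(@cvg_bohr H (f @ nbhs (x : bohr_space G)) (f x) _) => chi.
exact: ((@cvg_bohr G (nbhs (x : bohr_space G)) x _).1 (fun A => id)
  (chi \o f : {additive G -> circle R})).
Defined.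

End Bohr.

(* Main.v *)
Require Import Defs.
From HB Require Import structures.
From mathcomp Require Import all_boot all_order all_algebra.
From mathcomp Require Import all_classical reals topology normedtype.
From mathcomp Require Import lra.

(* Finite-index subgroups N are open for nu because N contains mG for some m > 0,
   and for the Bohr topology because characters of the finite group G/N separate
   points. Conversely, let V be a neighbourhood of 0 for a group topology coarser
   than both; V contains some mG and some Bohr ball
   {x | forall i, chi_i x is e-close to 0} given by n characters, so it suffices
   to show that the closure N of mG for the pseudo-metric defined by the chi_i has
   finite index, since N is contained in the sum of mG and the ball.

   If x_1, ..., x_r are distinct modulo N, they are d-separated modulo mG for some
   d > 0. Let S be the size of a maximal d-separated family m w_j in mG. The r S
   points x_i + m w_j are d-separated, multiplication by m sends each of them
   d-close to some m w_k, and for fixed k at most m^n of them go there, because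
   t in R/Z is determined by m t up to m choices, an error on m t being divided by
   m. Hence r S <= S m^n, that is r <= m^n. *)

Set Implicit Arguments.
Unset Strict Implicit.
Unset Printing Implicit Defensive.

Import Order.TTheory GRing.Theory Num.Theory.
Import numFieldNormedType.Exports.

Local Open Scope classical_set_scope.
Local Open Scope ring_scope.

(** * Comparison of group topologies at 0, subgroups, maximal separated families *)

Lemma gt_leP (G : zmodType) (s t : group_topology G) :
  (forall A : set G, nbhs (0 : gt_space s) A -> nbhs (0 : gt_space t) A) <->
  gt_le s t.
Proof.
(* Translations are continuous: freeze the second argument of the subtraction at [y - x]. *)
have shift (u : group_topology G) (x y : G) (A : set G) :
    nbhs (x : gt_space u) A ->
    nbhs (y : gt_space u) [set z | A (z - (y - x))].
  move=> xA; have := @gt_sub_continuous G u (y, y - x) A.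
  rewrite /= subKr => /(_ xA)[[U V] /= [yU yxV] UV].
  by apply: filterS yU => z Uz; apply: (UV (z, y - x)); split=> //;
    exact: (@nbhs_singleton (gt_space u)).
split=> [st U|st A].
  rewrite !openE => oU x /oU /(shift s x 0) /st /(shift t 0 x).
  by rewrite /interior/=; apply: filterS => z; rewrite /= subr0 sub0r opprK subrK.
rewrite !nbhsE => -[U [oU U0] UA]; exists U => //; split=> //; exact: st.
Qed.

Lemma subgroupN (G : zmodType) (N : set G) : is_subgroup N ->
  forall x, N x -> N (- x).
Proof. by move=> [N0 NB] x Nx; rewrite -sub0r; exact: NB. Qed.

Lemma subgroupD (G : zmodType) (N : set G) : is_subgroup N ->
  forall x y, N x -> N y -> N (x + y).
Proof.
move=> sN x y Nx Ny; rewrite -[y]opprK; apply: sN.2 => //.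
exact: subgroupN.
Qed.

Lemma subgroupMn (G : zmodType) (N : set G) : is_subgroup N ->
  forall x n, N x -> N (x *+ n).
Proof.
move=> sN x n Nx; elim: n => [|n IH]; first exact: sN.1.
by rewrite mulrS; exact: subgroupD.
Qed.

Lemma subgroupMz (G : zmodType) (N : set G) : is_subgroup N ->
  forall x (k : int), N x -> N (x *~ k).
Proof.
move=> sN x [] n Nx; first exact: subgroupMn.
by apply: subgroupN => //; exact: subgroupMn.
Qed.

(* The bound [K] on the size of separated families yields a maximal one, since
   an uncovered point would extend it. *)
Lemma max_separated (T : Type) (x0 : T) (close : T -> T -> Prop) (K : nat) :
  (forall n (x : nat -> T),
    (forall i j, (i < j < n)%N -> ~ close (x i) (x j)) -> (n <= K)%N) ->
  exists n (x : nat -> T), (forall i j, (i < j < n)%N -> ~ close (x i) (x j)) /\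
    forall z, exists2 i, (i < n)%N & close (x i) z.
Proof.
move=> bnd; pose P n := `[< exists x : nat -> T,
  forall i j, (i < j < n)%N -> ~ close (x i) (x j) >].
have P0 : exists n, P n.
  by exists 0%N; apply/asboolP; exists (fun=> x0) => i j; rewrite ltn0 andbF.
have PK n : P n -> (n <= K)%N by move=> /asboolP[x]; exact: bnd.
case: (ex_maxnP P0 PK) => n /asboolP[x xsep] nmax; exists n, x; split=> // z.
apply: contrapT => nz; suff /nmax : P n.+1 by rewrite ltnn.
apply/asboolP; exists (fun k => if (k < n)%N then x k else z) => i j /andP[ij].
rewrite ltnS leq_eqVlt => /predU1P[jn|jn].
  by rewrite jn ltnn -jn ij => cl; apply: nz; exists i; rewrite -?jn.
by rewrite jn (ltn_trans ij jn); apply: xsep; rewrite ij.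
Qed.

(** * Balls around 0 in the circle *)

Section CircleBall.
Variable R : realType.
Local Notation T := (circle R).

HB.instance Definition _ :=
  GRing.isZmodMorphism.Build R T (@circle_pi R) (@circle_piB R).

Lemma circle_pi_int (k : int) : circle_pi (k%:~R : R) = 0.
Proof.
have /eqP : (k%:~R == 0 %[mod @Quotient.quot R (@integer R)])%qT.
  by rewrite -Quotient.idealrBE subr0; exact: intr_int.
move=> e; rewrite -[RHS](raddf0 (@circle_pi R)); exact: e.
Qed.

Definition circle_ball (e : R) : set T := @circle_pi R @` [set u | `|u| < e].

Lemma circle_ball0 e : 0 < e -> circle_ball e 0.
Proof. by move=> e0; exists 0; rewrite /= ?normr0// raddf0. Qed.

Lemma circle_ballN e t : circle_ball e t -> circle_ball e (- t).
Proof. by move=> [u ue <-]; exists (- u); rewrite /= ?normrN// raddfN. Qed.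

Lemma circle_ballB e d s t :
  circle_ball e s -> circle_ball d t -> circle_ball (e + d) (s - t).
Proof.
move=> [u ue <-] [v vd <-]; exists (u - v); last by rewrite raddfB.
by rewrite /= (le_lt_trans (ler_normB _ _))// ltrD.
Qed.

Lemma circle_ball_le e d t : e <= d -> circle_ball e t -> circle_ball d t.
Proof. by move=> ed [u ue <-]; exists u => //=; exact: lt_le_trans ed. Qed.

Lemma circle_ball1 t : circle_ball 1 t.
Proof.
have [x ->] := circle_pi_surj t; exists (x - (Num.floor x)%:~R); last first.
  by rewrite raddfB/= circle_pi_int subr0.
have /andP[xl xr] := floor_itv x.
by rewrite /= ger0_norm ?subr_ge0// ltrBlDl -[1]/(1%:~R) -intrD.
Qed.

Lemma nbhs_circle_ball (A : set T) :
  nbhs (0 : T) A -> exists2 e : R, 0 < e & circle_ball e `<=` A.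
Proof.
move=> A0; have : nbhs (0 : R) (@circle_pi R @^-1` A).
  apply: (@pi_continuous R (@Quotient.quot R (@integer R)) 0).
  rewrite -[X in nbhs X](raddf0 (@circle_pi R)) in A0; exact: A0.
move=> /nbhs_ballP[e /= e0 eA]; exists e => // _ [u ue <-].
by apply: eA; rewrite /ball/= sub0r normrN.
Qed.

Lemma nbhs_neq0 (t : T) : t <> 0 -> nbhs (0 : T) [set s | s <> t].
Proof.
have [x -> xN0] := circle_pi_surj t.
have /andP[xl xr] := floor_itv x.
have xl' : 0 < x - (Num.floor x)%:~R.
  rewrite subr_gt0 lt_neqAle xl andbT; apply/eqP => xx.
  by apply: xN0; rewrite -xx circle_pi_int.
(* [e] is the distance from [x] to the integers: a representative [u = x + k] with [|u| < e] would
   put the integer [floor x + k] strictly between -1 and 0. *)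
pose e := Num.min (x - (Num.floor x)%:~R) ((Num.floor x + 1)%:~R - x).
have e0 : 0 < e by rewrite lt_min xl' subr_gt0.
have : nbhs (0 : T) (@circle_pi R @` ball 0 e).
  apply: open_nbhs_nbhs; split.
    by apply: circle_pi_open; exact: ball_open.
  by exists 0; rewrite ?raddf0//; exact: ballxx.
apply: filterS => _ [u ue <-] /circle_pi_eq /intrP[k ux].
move: ue; rewrite /ball/= sub0r normrN lt_min => /andP[].
rewrite !ltr_norml => /andP[ul ur] /andP[ul' ur'].
have kE : u = x + k%:~R by rewrite -ux addrC subrK.
have : (Num.floor x + k < 0)%R by rewrite -(ltr_int R) intrD; lra.
have : (0 < Num.floor x + k + 1)%R.
  by rewrite -(ltr_int R) addrAC intrD; lra.
by rewrite ltzD1 => /le_lt_trans h /h; rewrite ltxx.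
Qed.

(* Up to a small error, multiplication by [m] is at most [m]-to-one. *)
Lemma circle_ball_mulrn m e t : (0 < m)%N -> circle_ball e (t *+ m) ->
  exists c : 'I_m, circle_ball (e / m%:R) (t - circle_pi (c%:R / m%:R)).
Proof.
move=> m0; have [x ->] := circle_pi_surj t.
rewrite -raddfMn => -[u ue /circle_pi_eq /intrP[k uk]].
have mR0 : (m%:R : R) != 0 by rewrite pnatr_eq0 -lt0n.
have mZ0 : (m : int) != 0 by rewrite eqz_nat -lt0n.
(* Over the reals, [m x = u - k]. The branch [c] is the residue of [- k] modulo [m]; the quotient is
   an integer, killed by [circle_pi]. *)
have := modz_ge0 (- k) mZ0; have := ltz_pmod (- k) (m0 : 0 < m%:Z).
case E : modz => [c|//] cm _.
exists (Ordinal (cm : (c < m)%N)), (u / m%:R) => /=.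
  by rewrite normrM normfV normr_nat ltr_pM2r// invr_gt0 ltr0n.
have -> : u / m%:R = x - c%:R / m%:R - ((- k) %/ m)%Z%:~R.
  apply: (mulIf mR0); rewrite divfK// !mulrBl divfK//.
  have := congr1 (fun z : int => z%:~R : R) (divz_eq (- k) m).
  rewrite E rmorphN rmorphD rmorphM/= -!pmulrn mulr_natr; move: uk.
  lra.
by rewrite !raddfB/= circle_pi_int subr0.
Qed.
End CircleBall.

(** * Bohr balls and the finite index of closures of mG *)

Section BohrBall.
Variables (R : realType) (G : zmodType).
Local Notation char := {additive G -> circle R}.

Definition bohr_ball (I : finType) (chi : I -> char) (e : R) : set G :=
  [set x | forall i, circle_ball e (chi i x)].

(** The sets containing a ball form a filter that every character sends to 0, so this filter
    converges to 0 in the Bohr topology. *)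
Lemma bohr_nbhs0 (W : set G) : nbhs (0 : bohr_space R G) W ->
  exists (I : finType) (chi : I -> char) (e : R), 0 < e /\
    bohr_ball chi e `<=` W.
Proof.
pose F : set_system G := [set A : set G |
  exists (I : finType) (chi : I -> char) (e : R), 0 < e /\ bohr_ball chi e `<=` A].
have FF : Filter F.
  split=> [|A B [I [chi [e [e0 eA]]]] [J [psi [d [d0 dB]]]]|A B AB].
  - by exists void, (fun i : void => match i with end), 1.
  - exists (I + J)%type,
      (fun k => match k with inl i => chi i | inr j => psi j end),
      (Num.min e d).
    split=> [|x xb]; first by rewrite lt_min e0.
    split.
      by apply: eA => i; apply: circle_ball_le (xb (inl i)); rewrite ge_min lexx.
    apply: dB => j.
    by apply: circle_ball_le (xb (inr j)); rewrite ge_min lexx orbT.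
  - move=> [I [chi [e [e0 eA]]]]; exists I, chi, e; split=> //.
    exact: subset_trans AB.
suff : F --> (0 : bohr_space R G) by exact.
apply/cvg_bohr => chi A; rewrite raddf0 => /nbhs_circle_ball[e e0 eA].
by exists unit, (fun=> chi), e; split=> // x /(_ tt) /eA.
Qed.

Variables (I : finType) (chi : I -> char).
Local Notation ball := (bohr_ball chi).

Lemma bohr_ball0 e : 0 < e -> ball e 0.
Proof. by move=> e0 i; rewrite raddf0; exact: circle_ball0. Qed.

Lemma bohr_ballN e x : ball e x -> ball e (- x).
Proof. by move=> xe i; rewrite raddfN; exact: circle_ballN. Qed.

Lemma bohr_ballB e d x y : ball e x -> ball d y -> ball (e + d) (x - y).
Proof. by move=> xe yd i; rewrite raddfB; exact: circle_ballB. Qed.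

Lemma bohr_ball_le e d x : e <= d -> ball e x -> ball d x.
Proof. by move=> ed xe i; exact: circle_ball_le (xe i). Qed.

Lemma bohr_ball1 x : ball 1 x.
Proof. by move=> i; exact: circle_ball1. Qed.

(** The cell of [x] lists the branch [c] chosen by each character; for equal cells the terms [c / m]
    cancel and two errors [e / m] remain. *)
Lemma bohr_ball_mulrn m e : (0 < m)%N ->
  exists cell : G -> {ffun I -> 'I_m}, forall x y,
    ball e (x *+ m) -> ball e (y *+ m) -> cell x = cell y ->
    ball (e / m%:R + e / m%:R) (x - y).
Proof.
move=> m0.
have /choice[c cP] : forall t : circle R, exists c : 'I_m,
    circle_ball e (t *+ m) ->
    circle_ball (e / m%:R) (t - circle_pi (c%:R / m%:R)).
  move=> t; have [te|nte] := pselect (circle_ball e (t *+ m)).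
    by have [c ?] := circle_ball_mulrn m0 te; exists c.
  (* Arbitrary branch where [t *+ m] is not [e]-close to 0. *)
  by exists (Ordinal m0).
exists (fun x => [ffun i => c (chi i x)]) => x y xe ye /ffunP cxy i.
have := cxy i; rewrite !ffunE => {}cxy.
have /cP xc : circle_ball e (chi i x *+ m) by rewrite -raddfMn.
have /cP yc : circle_ball e (chi i y *+ m) by rewrite -raddfMn.
have := circle_ballB xc yc; rewrite cxy (raddfB (chi i)).
by rewrite opprB addrA subrK.
Qed.

Definition bohr_closure (A : set G) : set G :=
  [set x | forall e, 0 < e -> exists2 y, A y & ball e (x - y)].

Lemma bohr_closure_subgroup A : is_subgroup A -> is_subgroup (bohr_closure A).
Proof.
move=> [A0 AB]; split=> [e e0|x y xA yA e e0].
  by exists 0; rewrite ?subr0//; exact: bohr_ball0.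
have e20 : 0 < e / 2 by rewrite divr_gt0.
have [a Aa ax] := xA _ e20; have [b Ab yb] := yA _ e20.
exists (a - b); first exact: AB.
by rewrite opprD addrACA -opprD [e]splitr; exact: bohr_ballB.
Qed.

(** Total boundedness: balls of radius 1 are everything, so the cells for a multiplier [q > 2 / d]
    cover [G] by finitely many sets of pairwise [d]-close points. *)
Lemma separated_multiples m d : 0 < d ->
  exists n (w : nat -> G),
  (forall i j, (i < j < n)%N -> ~ ball d ((w i - w j) *+ m)) /\
  forall z, exists2 i, (i < n)%N & ball d ((w i - z) *+ m).
Proof.
move=> d0; pose q := (Num.truncn (2 / d)).+1.
have qd : 1 / q%:R + 1 / q%:R <= d.
  rewrite -mulrDl ler_pdivrMr ?ltr0n// mulrC -ler_pdivrMr//.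
  exact/ltW/truncnS_gt.
have [cell cellP] := bohr_ball_mulrn 1 (isT : (0 < q)%N).
apply: (@max_separated _ 0 (fun x y => ball d ((x - y) *+ m))
  #|{ffun I -> 'I_q}|) => n x xsep.
pose f (i : 'I_n) := cell (x i *+ m).
suff /leq_card : injective f by rewrite card_ord.
have sep (i j : 'I_n) : f i = f j -> ~ (i < j)%N.
  move=> fij ij; apply: (xsep i j); first by rewrite ij ltn_ord.
  by rewrite mulrnBl; apply: bohr_ball_le qd _; apply: cellP fij;
    exact: bohr_ball1.
move=> i j fij; apply/val_inj; case: (ltngtP i j) => // /sep.
  by case.
by rewrite fij; case.
Qed.

Lemma card_separated_closure m n (x : nat -> G) : (1 < m)%N ->
  (forall i j, (i < j < n)%N -> ~ bohr_closure (multiples G m) (x i - x j)) ->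
  (n <= #|{ffun I -> 'I_m}|)%N.
Proof.
move=> m1 xsep.
(* Each pair is kept apart modulo mG by every small enough radius; there are finitely many pairs, so
   one [d] serves all. *)
have [d d0 dsep] : exists2 d : R, 0 < d & forall i j y, (i < j < n)%N ->
    ~ ball d (x i - x j - y *+ m).
  have : \forall d \near 0^'+, forall p : 'I_n * 'I_n, (p.1 < p.2)%N ->
      forall y, ~ ball (d : R) (x p.1 - x p.2 - y *+ m).
    apply: filter_forall => -[i j] /=.
    have [ij|_] := boolP (i < j)%N; last exact: nearW.
    have : ~ bohr_closure (multiples G m) (x i - x j).
      by apply: xsep; rewrite ij ltn_ord.
    move=> /existsNP[e /not_implyP[e0 ne]].
    near=> d => _ y yd; apply: ne; exists (y *+ m); first by exists y.
    by apply: bohr_ball_le yd; near: d; exact: nbhs_right_le.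
  move=> dP; near (0 : R)^'+ => d.
  have dP' : forall p : 'I_n * 'I_n, (p.1 < p.2)%N ->
      forall y, ~ ball d (x p.1 - x p.2 - y *+ m) by near: d.
  exists d => // i j y /andP[ij jn].
  exact: (dP' (Ordinal (ltn_trans ij jn), Ordinal jn) ij).
have [S [w [wsep wcov]]] := separated_multiples m d0.
(* Some [w i] covers 0; this lets [S] be cancelled in the final count. *)
have S0 : (0 < S)%N by have [i iS _] := wcov 0; exact: leq_trans iS.
have m0 : (0 < m)%N by exact: ltnW.
have [cell cellP] := bohr_ball_mulrn d m0.
(* Here [1 < m] is used: two points with the same image under [f] end up [d]-close. *)
have dm : d / m%:R + d / m%:R <= d.
  by rewrite -mulrDl ler_pdivrMr ?ltr0n// -mulr2n -[d *+ 2]mulr_natr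
    ler_pM2l// ler_nat.
pose z (p : 'I_n * 'I_S) := x p.1 + w p.2 *+ m.
have /choice[c cP] : forall y, exists i : 'I_S, ball d ((y - w i) *+ m).
  move=> y; have [i iS] := wcov y; exists (Ordinal iS) => /=.
  by rewrite -opprB mulNrn; exact: bohr_ballN.
(* A centre close to [z p *+ m], and the cell of [z p] relative to it. A collision contradicts
   [dsep] if the first indices differ, [wsep] otherwise. *)
pose f p := (c (z p), cell (z p - w (c (z p)))).
have close p q : f p = f q -> ball d (z p - z q).
  move=> [cpq cellpq]; apply: bohr_ball_le dm _.
  have -> : z p - z q = (z p - w (c (z p))) - (z q - w (c (z q))).
    by rewrite cpq opprB addrA subrK.
  exact: cellP.
have close1 p q : f p = f q -> ~ (p.1 < q.1)%N.
  move=> fpq lt; apply: (dsep p.1 q.1 (w q.2 - w p.2)).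
    by rewrite lt ltn_ord.
  by have := close _ _ fpq; rewrite /z mulrnBl opprB opprD addrACA.
have close2 p q : f p = f q -> p.1 = q.1 -> ~ (p.2 < q.2)%N.
  move=> fpq eq1 lt; apply: (wsep p.2 q.2); first by rewrite lt ltn_ord.
  by have := close _ _ fpq; rewrite /z eq1 opprD addrACA subrr add0r mulrnBl.
suff /leq_card : injective f.
  by rewrite !card_prod !card_ord mulnC leq_pmul2l.
move=> p q fpq; have eq1 : p.1 = q.1.
  apply/val_inj; case: (ltngtP p.1 q.1) => // [/close1|/close1]; last first.
    by rewrite fpq; case.
  by case.
have eq2 : p.2 = q.2.
  apply/val_inj; case: (ltngtP p.2 q.2) => // [/close2|/close2]; last first.
    by rewrite fpq eq1; case.
  by case.
by rewrite [p]surjective_pairing eq1 eq2 -surjective_pairing.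
Unshelve. all: by end_near. Qed.

(** A maximal family of points incongruent modulo the closure represents every coset. *)
Lemma finite_index_bohr_closure m : (1 < m)%N ->
  finite_index (bohr_closure (multiples G m)).
Proof.
move=> m1; have [] : is_subgroup (bohr_closure (multiples G m)).
  apply/bohr_closure_subgroup/(sb_subgroup (s := natural_base G)).
  by exists m => //=; exact: ltnW.
set N := bohr_closure _ => N0 NB; split=> //.
have [n [x [_ xcov]]] := @max_separated _ 0 (fun x y => N (x - y)) _
  (fun n x => @card_separated_closure m n x m1).
apply: (@sub_finite_set _ _ [set coset (x i) N | i in `I_n]); last first.
  exact/finite_image/finite_II.
move=> _ [z _ <-]; have [i iN xiz] := xcov z; exists i => //.
apply/seteqP; split=> _ [a Na <-].
  exists (x i - z + a); last by rewrite addrA addrCA subrr addr0.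
  by apply: (subgroupD (conj N0 NB)).
exists (a - (x i - z)); first exact: NB.
by rewrite opprB addrA addrAC addrCA subrr addr0 addrC.
Qed.

End BohrBall.

(** * Finite-index subgroups in the natural topology *)

Lemma finite_index_multiples (G : zmodType) (N : set G) : finite_index N ->
  exists2 m, (0 < m)%N & multiples G m `<=` N.
Proof.
move=> [sN /finite_setP[r]].
rewrite card_eq_sym => /card_set_bijP[c [_ _ csurj]].
have /choice[f fP] : forall x, exists i : 'I_r, c i = coset x N.
  move=> x; have [|i ir ci] := csurj (coset x N); first by exists x.
  by exists (Ordinal ir).
(* Two of the [r + 1] multiples 0, x, ..., rx share one of the [r] cosets; their indices differ by
   at most [r], hence by a divisor of the factorial. *)
exists r`!; first exact: fact_gt0.
move=> _ [x _ <-].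
have /injectivePn[i [j ij fij]] : ~~ injectiveb (fun i : 'I_r.+1 => f (x *+ i)).
  by apply/negP => /injectiveP /leq_card; rewrite !card_ord ltnn.
have Nd (i' j' : 'I_r.+1) : (i' < j')%N -> f (x *+ i') = f (x *+ j') ->
    N (x *+ r`!).
  move=> ltij eqf; have : coset (x *+ j') N (x *+ j').
    by exists 0; [exact: sN.1|rewrite addr0].
  rewrite -fP -eqf fP => -[n Nn nE].
  have Nx : N (x *+ (j' - i')).
    by rewrite mulrnBr 1?ltnW// -nE addrC addKr.
  have /dvdnP[k ->] : (j' - i' %| r`!)%N.
    rewrite dvdn_fact// subn_gt0 ltij/= (leq_trans (leq_subr _ _))//.
    by rewrite -ltnS.
  by rewrite mulnC mulrnA; exact: subgroupMn.
move: ij; rewrite neq_ltn => /orP[ij|ij]; first exact: Nd fij.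
by apply: Nd ij _.
Qed.

(** * Extension of homomorphisms into a divisible group *)

Section CharacterExtension.
Variables (G A : zmodType).

(* Partially defined homomorphisms, as graphs. *)
Definition partial_hom (D : set (G * A)) : Prop :=
  is_subgroup D /\ forall a, D (0, a) -> a = 0.

(** [E] is [D] plus the multiples of [(x, s)]. It stays single-valued since, by minimality of [n],
    [x *~ k] is in the domain only for [k] divisible by [n], where [s] agrees with [D]. *)
Lemma partial_hom_extend (D : set (G * A)) (x : G) (n : nat) (s : A) :
  partial_hom D -> (0 < n)%N -> D (x *+ n, s *+ n) ->
  (forall k b, (0 < k)%N -> D (x *+ k, b) -> (n <= k)%N) ->
  let E := [set p | exists k : int, D (p.1 - x *~ k, p.2 - s *~ k)] in
  [/\ partial_hom E, D `<=` E & E (x, s)].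
Proof.
move=> [sD D0] n0 Dn nmin E; split; last 1 first.
- by exists 1; rewrite !mulr1z !subrr; exact: sD.1.
- split.
    split; first by exists 0; rewrite !mulr0z !subr0; exact: sD.1.
    move=> [y b] [z c] [k /= Dk] [l /= Dl]; exists (k - l) => /=.
    have := sD.2 _ _ Dk Dl; congr (D (_, _)).
      by rewrite mulrzBr opprD addrACA -opprD.
    by rewrite mulrzBr opprD addrACA -opprD.
  move=> a [k /=]; rewrite sub0r => Dk.
  have {}Dk : D (x *~ k, s *~ k - a).
    by have := subgroupN sD Dk; congr (D (_, _)); rewrite /= ?opprK ?opprB.
  have Dnz (l : int) : D (x *~ (l * n), s *~ (l * n)).
    have := subgroupMz sD l Dn.
    rewrite mulrC !mulrzA -!pmulrn; congr (D _).
    by apply: injective_projections; exact: (raddfMz (_ : {additive _ -> _})).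
  have n0' : (n : int) != 0 by rewrite eqz_nat -lt0n.
  have Dr : D (x *~ (k %% n)%Z, s *~ (k %% n)%Z - a).
    have := sD.2 _ _ Dk (Dnz (k %/ n)%Z); congr (D (_, _)).
      by rewrite /modz mulrzBr.
    by rewrite /modz mulrzBr addrAC.
  have := modz_ge0 k n0'; have := ltz_pmod k (n0 : 0 < n%:Z).
  move: Dr; case: modz => [[|c]|//] Dr cn _; last first.
    by have := nmin c.+1 _ isT Dr; rewrite leqNgt -ltz_nat cn.
  have /D0 /eqP : D (0, 0 - a) by exact: Dr.
  by rewrite sub0r oppr_eq0 => /eqP.
- by move=> [y b] Dyb; exists 0; rewrite /= !mulr0z !subr0.
Qed.

(* Zorn's lemma on graphs; the empty chain has an empty union, so [P] only asks
   nonempty graphs to extend [D]. *)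
Lemma partial_hom_total (D : set (G * A)) :
  (forall n (a : A), (0 < n)%N -> exists b, b *+ n = a) ->
  partial_hom D ->
  (forall x, exists n, (0 < n)%N /\ exists b, D (x *+ n, b)) ->
  exists f : {additive G -> A}, forall x a, D (x, a) -> f x = a.
Proof.
move=> divA homD torsD.
pose P (E : set (G * A)) := [/\ forall p q, E p -> E q -> E (p - q),
  forall a, E (0, a) -> a = 0 & E !=set0 -> D `<=` E].
have PD : P D by case: homD => -[_ DB] D0; split=> // _ ?.
have [F FP Ftot|M [[MB M0 MD] Mmax]] := @Zorn_bigcup _ P.
  split=> [p q [X FX Xp] [Y FY Yq]|a [X FX]|].
  - have [XY|YX] := Ftot _ _ FX FY.
      by exists Y => //; have [YB _ _] := FP _ FY; apply: YB => //; exact: XY.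
    by exists X => //; have [XB _ _] := FP _ FX; apply: XB => //; exact: YX.
  - by have [_ X0 _] := FP _ FX; exact: X0.
  - move=> [p [X FX Xp]] q Dq; exists X => //.
    by have [_ _ XD] := FP _ FX; apply: XD => //; exists p.
have {}MD : D `<=` M.
  (* An empty [M] would not be maximal, as [D] contains 0. *)
  apply: MD; apply: contrapT => /set0P/negP/negPn/eqP Me.
  apply: (Mmax D) => //; rewrite Me; split=> // /(_ 0); apply.
  exact: homD.1.1.
have homM : partial_hom M.
  by split=> //; split=> //; apply: MD; exact: homD.1.1.
have /choice[f fM] : forall x, exists s, M (x, s).
  move=> x; pose Q n := (0 < n)%N && `[< exists b, M (x *+ n, b) >].
  have exQ : exists n, Q n.
    have [n [n0 [b Db]]] := torsD x; exists n; rewrite /Q n0.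
    by apply/asboolP; exists b; exact: MD.
  case: (ex_minnP exQ) => n /andP[n0 /asboolP[b Mb]] nmin.
  have [s sb] := divA n b n0; rewrite -sb in Mb.
  have [|] := partial_hom_extend homM n0 Mb.
    by move=> k c k0 Mk; apply: nmin; rewrite /Q k0; apply/asboolP; exists c.
  set E := (X in partial_hom X) => homE ME Ex; exists s.
  apply: contrapT => nMx; apply: (Mmax E).
    by split=> // /(_ _ Ex).
  split; [exact: homE.1.2|exact: homE.2|move=> _].
  exact: subset_trans MD ME.
have funM x a b : M (x, a) -> M (x, b) -> a = b.
  move=> Ma Mb; apply/eqP; rewrite -subr_eq0; apply/eqP/M0.
  by have := MB _ _ Ma Mb; congr (M (_, _)); rewrite /= subrr.
have fB : {morph f : x y / x - y}.
  by move=> x y; apply: (funM (x - y)); [exact: fM|exact: MB (fM x) (fM y)].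
pose fa : {additive G -> A} :=
  HB.pack f (GRing.isZmodMorphism.Build G A f fB).
exists fa => x a Da /=.
by apply: (funM x); [exact: fM|exact: MD].
Qed.

End CharacterExtension.

(** * Finite-index subgroups in the Bohr topology *)

Section BohrFiniteIndex.
Variables (R : realType) (G : zmodType).

Lemma circle_divisible n (t : circle R) : (0 < n)%N -> exists s, s *+ n = t.
Proof.
move=> n0; have [x ->] := circle_pi_surj t; exists (circle_pi (x / n%:R)).
by rewrite -raddfMn -[_ *+ n]mulr_natr divfK// pnatr_eq0 -lt0n.
Qed.

Lemma circle_pi_inv_neq0 n : (1 < n)%N -> circle_pi (n%:R^-1 : R) <> 0.
Proof.
move=> n1; rewrite -(raddf0 (@circle_pi R)) => /circle_pi_eq.
rewrite subr0 => /intrP[k nk].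
have : (0 < k)%R by rewrite -(ltr_int R) -nk invr_gt0 ltr0n ltnW.
have : (k < 1)%R.
  by rewrite -(ltr_int R) -nk invf_lt1 ?ltr1n// ltr0n ltnW.
by rewrite -[1]add0r ltzD1 => /le_lt_trans h /h; rewrite ltxx.
Qed.

(** Extend the zero map on [N] by sending [g] to [1 / n], where [n > 1] is the order of [g] modulo
    [N], then to all of [G], since [G / N] is torsion. *)
Lemma char_separation (N : set G) (g : G) : finite_index N -> ~ N g ->
  exists2 chi : {additive G -> circle R}, (forall x, N x -> chi x = 0) &
    chi g <> 0.
Proof.
move=> fN ng; have [m m0 mN] := finite_index_multiples fN; have sN := fN.1.
pose D : set (G * circle R) := [set p | N p.1 /\ p.2 = 0].
have homD : partial_hom D.
  split=> [|a []//]; split; first by split=> //; exact: sN.1.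
  by move=> p q [Np p0] [Nq q0]; split; [exact: sN.2|rewrite /= p0 q0 subr0].
pose Q n := (0 < n)%N && `[< N (g *+ n) >].
have exQ : exists n, Q n.
  by exists m; rewrite /Q m0; apply/asboolP/mN; exists g.
case: (ex_minnP exQ) => n /andP[n0 /asboolP Nn] nmin.
have n1 : (1 < n)%N.
  rewrite ltn_neqAle n0 andbT; apply/eqP => n1.
  by apply: ng; rewrite -[g]mulr1n n1.
pose s : circle R := circle_pi n%:R^-1.
have sn : s *+ n = 0.
  rewrite -raddfMn -[_ *+ n]mulr_natr mulVf ?pnatr_eq0 -?lt0n//.
  exact: (circle_pi_int R 1).
have [||homE DE Eg] := @partial_hom_extend _ _ D g n s homD n0.
- by split.
- by move=> k b k0 [Nk _]; apply: nmin; rewrite /Q k0; apply/asboolP.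
have [|chi chiE] := partial_hom_total circle_divisible homE.
  move=> x; exists m; split=> //; exists 0; apply: DE; split=> //.
  by apply: mN; exists x.
exists chi => [x Nx|]; first by apply: chiE; apply: DE.
by rewrite (chiE _ _ Eg); exact: circle_pi_inv_neq0.
Qed.

(* A point outside [N] lies in one of finitely many cosets [g + N] with [~ N g],
   on which a character killing [N] takes the constant value [chi g <> 0]. *)
Lemma finite_index_bohr_nbhs (N : set G) : finite_index N ->
  nbhs (0 : bohr_space R G) N.
Proof.
move=> fN; have sN := fN.1.
have /choice[chi chiP] : forall g, exists chi : {additive G -> circle R},
    (forall x, N x -> chi x = 0) /\ (~ N g -> chi g <> 0).
  move=> g; have [Ng|Ng] := pselect (N g); last first.
    by have [chi ? ?] := char_separation fN Ng; exists chi.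
  (* For [g] in [N] there is nothing to separate. *)
  by exists \0.
have [r cN] := (finite_setP _).1 fN.2.
move: cN; rewrite card_eq_sym => /card_set_bijP[c [cfun _ csurj]].
have /choice[h hP] : forall i : 'I_r, exists g, coset g N = c i.
  by move=> i; have [g _ gi] := cfun i (ltn_ord i); exists g.
have FF := @nbhs_filter (bohr_space R G) 0.
have : \forall x \near (0 : bohr_space R G), forall i : 'I_r,
    ~ N (h i) -> chi (h i) x <> chi (h i) (h i).
  apply: (@filter_forall _ _ _ _ FF) => i.
  have [Ni|Ni] := pselect (N (h i)).
    by apply: nearW => x /(_ Ni).
  have := (@cvg_bohr R G _ 0 FF).1 (fun A => id) (chi (h i)).
  rewrite raddf0 => /(_ _ (nbhs_neq0 ((chiP (h i)).2 Ni))).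
  by apply: (@filterS _ _ FF) => x ? _.
apply: (@filterS _ _ FF) => x xP; apply: contrapT => Nx.
have [|i ir ci] := csurj (coset x N); first by exists x.
have := hP (Ordinal ir); rewrite /= ci; set g := h _ => gx.
have [n Nn gn] : coset x N g.
  by rewrite -gx; exists 0; [exact: sN.1|rewrite addr0].
apply: (xP (Ordinal ir)); rewrite -/g.
  move=> Ng; apply: Nx; rewrite -(addrK n x) gn; exact: sN.2.
have := raddfD (chi g) x n; rewrite gn => ->.
by rewrite ((chiP g).1 n Nn) addr0.
Qed.

End BohrFiniteIndex.

(** * The infimum, on each group and in the lattice *)

Lemma profinite_is_inf (R : realType) (G : zmodType) :
  is_inf (@gt_le G) (natural G) (bohr R G) (profinite G).
Proof.
split.
- apply/gt_leP => A; rewrite profinite_nbhs0 natural_nbhs0 => -[N fN NA].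
  have [m m0 mN] := finite_index_multiples fN; exists m => //.
  exact: subset_trans NA.
- apply/gt_leP => A; rewrite profinite_nbhs0 => -[N fN NA].
  by apply: filterS NA _; exact: finite_index_bohr_nbhs.
move=> t /gt_leP tnu /gt_leP tP; apply/gt_leP => A A0.
have := @gt_sub_continuous G t (0, 0) A; rewrite /= subrr.
move=> /(_ A0)[[U V] /= [U0 V0] UV].
have := tnu _ U0; rewrite natural_nbhs0 => -[m /= m0 mU].
have [I [chi [e [e0 eV]]]] := bohr_nbhs0 (tP _ V0).
(* Doubling [m] makes the multiplier exceed 1 even for [m = 1], and 2mG still lies in mG. *)
rewrite profinite_nbhs0; exists (bohr_closure chi (multiples G m.*2)).
  by apply: finite_index_bohr_closure; rewrite -addnn (leq_add m0 m0).
move=> x /(_ e e0)[_ [y _ <-] ye].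
rewrite -[x](subKr (y *+ m.*2)); apply: (UV (_, _)); split=> /=.
  by apply: mU; exists (y *+ 2); rewrite // -mulrnA mul2n.
by have := bohr_ballN ye; rewrite opprB; exact: eV.
Qed.

Theorem theorem2p13 (R : realType) :
  is_inf ft_le natural (bohr R) profinite /\
  (forall G : zmodType,
     is_inf (@gt_le G) (natural G) (bohr R G) (profinite G)).
Proof.
split=> [|G]; last exact: profinite_is_inf.
split=> [G|G|S Sn Sb G]; have [h1 h2 h3] := profinite_is_inf R G => //.
by apply: h3; [exact: Sn|exact: Sb].
Qed.
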